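(* In the setting described in the context, let $G=T^n\langle\theta\rangle$, let $E$ be a minimal normal subgroup of $F^n{:}\langle\theta\rangle$ such that (1) $E\cong\mathbb{Z}_p^{2f}$, (2) $\langle\theta\rangle$ acts transitively on $E\setminus\{1\}$ by conjugation (so $E{:}\langle\theta\rangle\cong\mathrm{AGL}_1(q^2)$), and (3) $\pi_i(E)=F$ for all $i$ and $\ker(\pi_i)\cap E\ne\ker(\pi_j)\cap E$ for $1\leqslant i<j\leqslant n$; and let $H=E{:}\langle\theta\rangle$. Then $G$, acting by right multiplication on the set $[G:H]$ of right cosets of $H$, is a quasiprimitive group of non-diagonal PA type, where $T^n\cap H$ is a subdirect product of $(R\cap T)^n$.
   Context: Setting: (C1) $q=p^f$ for a prime $p$ and integer $f\geqslant1$, and $n:=q+1=2^sr^t>3$ where $t\geqslant0$, $r$ is an odd prime, and either $s\geqslant2$ or $q$ is even. (C2) $X$ is an almost simple group with socle $T$, $|X:T|\leqslant2$, and $X$ has a subgroup $R\cong\mathrm{AGL}_1(q)$, written $R=F{:}(\langle b\rangle\times\langle c\rangle)$ with $F\cong\mathbb{Z}_p^f$, $b$ of order $\frac{q-1}{\gcd(2,q-1)}$ and $c$ of order $\gcd(2,q-1)$. (C3) $\tau=(1,2,\ldots,n)\in S_n$ and $W=X\wr\langle\tau\rangle=X^n{:}\langle\tau\rangle$ with $\tau^{-1}(x_1,\ldots,x_n)\tau=(x_n,x_1,\ldots,x_{n-1})$. (C4) $\pi_i:(x_1,\ldots,x_n)\mapsto x_i$ are the projections $X^n\to X$. Put $\mathbf{d}_0=(bc,b,bc,\ldots,bc)\in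 R^n$ (second coordinate $b$, all others $bc$) and $\theta=\mathbf{d}_0\tau\in W$. A transitive permutation group $G$ is quasiprimitive of PA type if every minimal normal subgroup of $G$ is transitive, $G$ has a unique minimal normal subgroup $M=T_1\times\cdots\times T_n$ with $n\geqslant2$ and the $T_i$ pairwise isomorphic nonabelian simple groups, and for a point $\omega$ there are pairwise isomorphic subgroups $1\ne R_i<T_i$ with $M_\omega\leqslant R_1\times\cdots\times R_n$ projecting surjectively onto each $R_i$ (i.e. $M_\omega$ is a subdirect product of $R_1\times\cdots\times R_n$); it is non-diagonal if some projection $M_\omega\to R_i$ is not injective. *)

(* Defs.v *)
From HB Require Import structures.
From mathcomp Require Import all_boot all_order all_algebra all_fingroup all_solvable all_field.
Set Implicit Arguments.
Unset Strict Implicit.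
Unset Printing Implicit Defensive.
Import GRing.Theory.

(* The wreath product  gT wr Z_n  (permutational, with the cyclic group of   *)
(* order n generated by tau = (1,2,...,n)).  An element (x, k) stands for    *)
(* x * tau^k with x = (x_i)_i in gT^n.  Coordinates are indexed by 'Z_n,     *)
(* index j : 'Z_n corresponding to the paper's coordinate j+1.              *)
(* Multiplication: (x,k)(y,l) = ([i => x_i * y_(i+k)], k+l), so that         *)
(* tau^-1 (x_1,...,x_n) tau = (x_n, x_1, ..., x_(n-1)) as in the paper.     *)

Definition wr (gT : finGroupType) (n : nat) := ({ffun 'Z_n -> gT} * 'Z_n)%type.

HB.instance Definition _ (gT : finGroupType) (n : nat) :=
  Finite.on (wr gT n).

Definition wr_mul (gT : finGroupType) n (u v : wr gT n) : wr gT n :=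
  ([ffun i => (u.1 i * v.1 (i + u.2)%R)%g], (u.2 + v.2)%R).
Definition wr_one (gT : finGroupType) n : wr gT n := ([ffun=> 1%g], 0%R).
Definition wr_inv (gT : finGroupType) n (u : wr gT n) : wr gT n :=
  ([ffun i => ((u.1 (i - u.2)%R)^-1)%g], (- u.2)%R).

Lemma wr_mulA (gT : finGroupType) n : associative (@wr_mul gT n).
Proof.
move=> [x k] [y l] [z m]; rewrite /wr_mul /=; congr (_, _); last by rewrite addrA.
by apply/ffunP => i; rewrite !ffunE mulgA addrA.
Qed.

Lemma wr_mul1 (gT : finGroupType) n : left_id (@wr_one gT n) (@wr_mul gT n).
Proof.
move=> [x k]; rewrite /wr_mul /=; congr (_, _); last by rewrite add0r.
by apply/ffunP => i; rewrite !ffunE mul1g addr0.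
Qed.

Lemma wr_mulV (gT : finGroupType) n :
  left_inverse (@wr_one gT n) (@wr_inv gT n) (@wr_mul gT n).
Proof.
move=> [x k]; rewrite /wr_mul /wr_one /=; congr (_, _); last by rewrite addNr.
by apply/ffunP => i; rewrite !ffunE /= mulVg.
Qed.


HB.instance Definition _ (gT : finGroupType) n :=
  Finite_isGroup.Build (wr gT n) (@wr_mulA gT n) (@wr_mul1 gT n) (@wr_mulV gT n).

Local Open Scope group_scope.

Definition proj (gT : finGroupType) n (i : 'Z_n) (w : wr gT n) : gT := w.1 i.

Definition baseS (gT : finGroupType) n (A : {set gT}) : {set wr gT n} :=
  [set w : wr gT n | (w.2 == 0%R) && [forall i, w.1 i \in A]].

Definition wreath (gT : finGroupType) n (X : {set gT}) : {set wr gT n} :=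
  [set w : wr gT n | [forall i, w.1 i \in X]].

Definition coord_copy (gT : finGroupType) n (A : {set gT}) (i : 'Z_n)
  : {set wr gT n} :=
  [set w : wr gT n | (w.2 == 0%R) &&
     [forall j, w.1 j \in (if j == i then A else [1 gT])]].

Definition tau (gT : finGroupType) n : wr gT n := ([ffun=> 1], 1%R).

Definition base_elt (gT : finGroupType) n (d : {ffun 'Z_n -> gT}) : wr gT n :=
  (d, 0%R).

(* d0 = (bc, b, bc, ..., bc): the paper's second coordinate (index 1) is b *)
Definition d0 (gT : finGroupType) n (b c : gT) : {ffun 'Z_n -> gT} :=
  [ffun i : 'Z_n => if i == 1%R then b else b * c].

Definition theta (gT : finGroupType) n (b c : gT) : wr gT n :=
  base_elt (d0 n b c) * tau gT n.

Definition min_normal_sub (gT : finGroupType) (M G : {set gT}) : Prop :=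
  minnormal M G /\ M \subset G.

Definition almost_simple_socle (gT : finGroupType) (X T : {set gT}) : Prop :=
  [/\ T <| X, simple T, ~~ abelian T & 'C_X(T) = 1].

Definition AGL1 (K : finFieldType) : {set {perm K}} :=
  [set s : {perm K} | [exists a : K, [exists b : K,
      (a != 0%R) && [forall x, s x == (a * x + b)%R]]]].

Definition elem_ab_rank (gT : finGroupType) (p k : nat) (E : {set gT}) : Prop :=
  p.-abelem E /\ #|E| = (p ^ k)%N.

(* Main.v *)
Require Import Defs.
From HB Require Import structures.
From mathcomp Require Import all_boot all_order all_algebra all_fingroup all_solvable all_field.
From mathcomp Require Import zify.

(* A nontrivial normal subgroup N of G meets T^n nontrivially, since T^n has
   trivial centraliser in X wr <tau>; commuting an element of N :&: T^n
   with a suitable element of one factor T_i puts a nontrivial element of T_i,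
   hence all of T_i, in N, and theta permutes the factors transitively, so
   T^n <= N.  As theta lies in H, G = T^n H, which gives transitivity of T^n.
   The arithmetic of (C1) makes #[b] odd, so theta^n, all of whose coordinates
   are b^n c^q, generates <b> x <c> in each coordinate; hence T^n :&: H projects
   onto R :&: T.  Here F <= T because F = R' and X/T is abelian.  The action is
   non-diagonal since |E| = q^2 while each projection of E is F, of order q. *)

Set Implicit Arguments.
Unset Strict Implicit.
Local Open Scope group_scope.

(** * Coordinates, factors and conjugation in the wreath product *)

Section WreathCoordinates.

Variables (gT : finGroupType) (n : nat).
Implicit Types (u v w : wr gT n) (i j : 'Z_n) (t : gT).

Lemma wr_eqP u v : u.2 = v.2 -> u.1 =1 v.1 -> u = v.
Proof. by case: u v => [x k] [y l] /= -> /ffunP->. Qed.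

Lemma wrM1 u v i : (u * v).1 i = u.1 i * v.1 (i + u.2)%R.
Proof. exact: ffunE. Qed.

Lemma wrM2 u v : (u * v).2 = (u.2 + v.2)%R. Proof. by []. Qed.

Lemma wrV1 u i : u^-1.1 i = (u.1 (i - u.2)%R)^-1.
Proof. exact: ffunE. Qed.

Lemma wrV2 u : u^-1.2 = (- u.2)%R. Proof. by []. Qed.

Lemma wr11 i : (1 : wr gT n).1 i = 1. Proof. exact: ffunE. Qed.

Lemma wr12 : (1 : wr gT n).2 = 0%R. Proof. by []. Qed.

Definition wrE := (wrM1, wrM2, wrV1, wrV2, wr11, wr12).

Lemma wrX2 w k : (w ^+ k).2 = (w.2 *+ k)%R.
Proof. by elim: k => [|k IH] //; rewrite expgS wrM2 IH GRing.mulrS. Qed.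

Lemma wrX1 w k i : (w ^+ k).1 i = \prod_(j < k) w.1 (i + w.2 *+ j)%R.
Proof.
elim: k => [|k IH]; first by rewrite big_ord0 wr11.
by rewrite expgSr wrM1 IH wrX2 big_ord_recr.
Qed.

(* Unifies [baseS] (constant family) and [coord_copy] (one nontrivial entry). *)
Definition baseF (A : 'Z_n -> {set gT}) : {set wr gT n} :=
  [set w : wr gT n | (w.2 == 0%R) && [forall i, w.1 i \in A i]].

Lemma baseFP (A : 'Z_n -> {set gT}) w :
  reflect (w.2 = 0%R /\ forall i, w.1 i \in A i) (w \in baseF A).
Proof.
by rewrite inE; apply: (iffP andP) => [[/eqP ? /forallP]|[-> /forallP]].
Qed.

Lemma baseSP (A : {set gT}) w :
  reflect (w.2 = 0%R /\ forall i, w.1 i \in A) (w \in baseS n A).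
Proof. exact: (baseFP (fun=> A)). Qed.

Lemma eq_baseF (A B : 'Z_n -> {set gT}) : A =1 B -> baseF A = baseF B.
Proof. by move=> eqAB; apply/setP=> w; rewrite !inE; under eq_forallb do rewrite eqAB. Qed.

Lemma baseF_group_set (A : 'Z_n -> {group gT}) :
  group_set (baseF (fun i => gval (A i))).
Proof.
apply/group_setP; split; first by apply/baseFP; split=> // i; rewrite wr11.
move=> u v /baseFP[u0 uA] /baseFP[v0 vA]; apply/baseFP; rewrite wrM2 u0 v0 GRing.addr0.
by split=> // i; rewrite wrM1 u0 GRing.addr0 groupM.
Qed.

Canonical baseF_group A := Group (baseF_group_set A).

Lemma baseS_group_set (A : {group gT}) : group_set (baseS n A).
Proof. exact: (baseF_group_set (fun=> A)). Qed.

Canonical baseS_group A := Group (baseS_group_set A).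

Lemma wreath_group_set (A : {group gT}) : group_set (wreath n A).
Proof.
apply/group_setP; split; first by rewrite inE; apply/forallP=> i; rewrite wr11.
move=> u v; rewrite !inE => /forallP uA /forallP vA; apply/forallP=> i.
by rewrite wrM1 groupM.
Qed.

Canonical wreath_group A := Group (wreath_group_set A).

Lemma wreathP (A : {set gT}) w : reflect (forall i, w.1 i \in A) (w \in wreath n A).
Proof. by rewrite inE; apply: forallP. Qed.

Lemma baseS_sub_wreath (A B : {set gT}) : A \subset B -> baseS n A \subset wreath n B.
Proof.
move=> /subsetP sAB; apply/subsetP=> w /baseSP[_ wA].
by apply/wreathP=> i; apply: sAB.
Qed.

Lemma base_conj1 u w i : u.2 = 0%R ->
  (u ^ w).1 i = u.1 (i - w.2)%R ^ w.1 (i - w.2)%R.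
Proof. by move=> u0; rewrite !conjgE !wrE u0 GRing.addr0. Qed.

Lemma base_conj2 u w : u.2 = 0%R -> (u ^ w).2 = 0%R.
Proof. by move=> u0; rewrite conjgE !wrE u0 GRing.add0r GRing.addNr. Qed.

Lemma wreath_norm_baseS (X T : {group gT}) :
  X \subset 'N(T) -> wreath n X \subset 'N(baseS n T).
Proof.
move=> /subsetP nTX; apply/subsetP=> w /wreathP wX; rewrite inE.
apply/subsetP=> _ /imsetP[u /baseSP[u0 uT] ->].
apply/baseSP; rewrite base_conj2 //; split=> // i.
by rewrite base_conj1 // memJ_norm ?nTX.
Qed.

Definition embed i t : wr gT n := ([ffun j => if j == i then t else 1], 0%R).

Lemma embed1E i t j : (embed i t).1 j = if j == i then t else 1.
Proof. exact: ffunE. Qed.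

Lemma embed_in_baseS (T : {group gT}) i t : t \in T -> embed i t \in baseS n T.
Proof. by move=> tT; apply/baseSP; split=> // j; rewrite embed1E; case: eqP. Qed.

(** Stated on the full set so that [embed i] becomes a morphism: its images identify the factors
    with T, and its preimages turn simplicity of T into a statement about each factor. *)
Lemma embedM i : {in [set: gT] &, {morph embed i : s t / s * t}}.
Proof.
move=> s t _ _; apply: wr_eqP => [|j]; first by rewrite wrM2 GRing.addr0.
by rewrite wrM1 GRing.addr0 !embed1E; case: eqP; rewrite ?mulg1.
Qed.

Canonical embed_morphism i := Morphism (embedM i).

Lemma embed_inj i : injective (embed i).
Proof. by move=> s t /(congr1 (fun w => w.1 i)); rewrite !embed1E eqxx. Qed.

(** Governs the permutation of the factors: the top component of [w] shifts the coordinate, while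
    its base entry there twists by conjugation. *)
Lemma embedJ i t w : embed i t ^ w = embed (i + w.2)%R (t ^ w.1 i).
Proof.
apply: wr_eqP => [|j]; first by rewrite base_conj2.
rewrite base_conj1 // !embed1E -GRing.subr_eq; case: eqP => [->|] //.
by rewrite conj1g.
Qed.

Lemma comm_embed i t w : w.2 = 0%R -> [~ w, embed i t] = embed i [~ w.1 i, t].
Proof.
move=> w0; have -> : [~ w, embed i t] = (embed i t ^ w)^-1 * embed i t.
  by rewrite commgEr conjVg.
by rewrite embedJ w0 GRing.addr0 -morphV ?inE // -morphM ?inE // commgEr conjVg.
Qed.

Lemma coord_copy_embed (T : {set gT}) i : coord_copy T i = embed i @: T.
Proof.
apply/setP=> w; apply/baseFP/imsetP=> [[w0 wT]|[t tT ->]].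
  exists (w.1 i); first by have:= wT i; rewrite eqxx.
  apply: wr_eqP => // j; rewrite embed1E; have:= wT j.
  by case: eqP => [->|_ /set1P].
by split=> // j; rewrite embed1E; case: eqP => // _; rewrite inE.
Qed.

Lemma coord_copy_isog (T : {group gT}) i : coord_copy T i \isog T.
Proof.
have -> : coord_copy T i = embed_morphism i @* T.
  by rewrite coord_copy_embed morphimEsub ?subsetT.
rewrite isog_sym sub_isog ?subsetT //.
by apply/injmP=> s t _ _; apply: embed_inj.
Qed.

(** Induction on a duplicate-free list of indices: the partial product consists of the base elements
    with entries in T on the list and trivial entries elsewhere. The full list of indices gives the
    claim. *)
Lemma bigdprod_coord_copy (T : {group gT}) :
  \big[dprod/1]_i coord_copy T i = baseS n T.
Proof.
pose A (r : seq 'Z_n) j : {group gT} := if j \in r then T else 1%G.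
suff {}IH r : uniq r -> \big[dprod/1]_(i <- r) coord_copy T i = baseF (A r).
  rewrite [LHS]IH ?index_enum_uniq //; apply: eq_baseF => j.
  by rewrite /A mem_index_enum.
elim: r => [_ | i r IH /= /andP[ri /IH{}IH]].
  rewrite big_nil; apply/setP=> w; apply/set1P/baseFP=> [->|[w0 w1]].
    by split=> // j; rewrite wr11.
  by apply: wr_eqP => // j; rewrite wr11; apply/set1P/w1.
have copyA : coord_copy T i = baseF (A [:: i]).
  by apply: eq_baseF => j; rewrite /A inE; case: eqP.
rewrite big_cons IH copyA dprodE.
- apply/eqP; rewrite eqEsubset mul_subG /=; last 1 first.
  + apply/subsetP=> w /baseFP[w0 wA]; apply/baseFP; split=> // j.
    by have := wA j; rewrite /A !inE; case: (j == i) => //=; case: ifP => // _ /set1P->.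
  + apply/subsetP=> w /baseFP[w0 wA].
    rewrite -(mulKVg (embed i (w.1 i)) w) mem_mulg //.
      rewrite -copyA coord_copy_embed imset_f //.
      by have := wA i; rewrite /A inE eqxx.
    apply/baseFP; rewrite !wrE w0 GRing.addr0 GRing.oppr0; split=> // j.
    rewrite !wrE GRing.oppr0 !GRing.addr0 embed1E.
    have [->|ji] := eqVneq j i; first by rewrite mulVg.
    by have := wA j; rewrite /A inE (negPf ji) invg1 mul1g.
  + apply/subsetP=> w /baseFP[w0 wA]; apply/baseFP; split=> // j.
    by have := wA j; rewrite /A !inE; case: (j == i) => //=; case: ifP => // _ /set1P->.
- apply/centsP=> u /baseFP[u0 uA] v /baseFP[v0 vA].
  apply: wr_eqP => [|j]; first by rewrite !wrM2 GRing.addrC.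
  rewrite !wrM1 u0 v0 !GRing.addr0.
  have := uA j; have := vA j; rewrite /A inE.
  case: eqP => [->|_ /set1P-> _]; last by rewrite mulg1 mul1g.
  by case: ifP => [ir|_ _ /set1P->]; [case/negP: ri | rewrite mulg1 mul1g].
- apply/trivgP/subsetP=> w /setIP[/baseFP[w0 wA] /baseFP[_ wB]].
  apply/set1P/wr_eqP => // j; rewrite wr11.
  have := wA j; have := wB j; rewrite /A mem_seq1.
  case: (j =P i) => [->|_ _ /set1P-> //]; case: ifP => [ir|_ /set1P-> //].
  by case/negP: ri.
Qed.

End WreathCoordinates.

(** * Normal subgroups of groups between the base group and the wreath product *)

Section MinimalNormal.

Variables (gT : finGroupType) (n : nat) (X T : {group gT}).
Hypothesis sXT : almost_simple_socle X T.


Lemma socle_cent1 x : x \in X -> x \in 'C(T) -> x = 1.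
Proof.
case: sXT => _ _ _ cXT xX xC; have: x \in 'C_X(T) by apply/setIP.
by rewrite cXT => /set1P.
Qed.

(** A nonzero top component would move a nontrivial element of factor 0 into another factor. So [w]
    lies in the base group, and each of its entries centralises T, hence is trivial. *)
Lemma cent_baseS w :
  w \in wreath n X -> (forall u, u \in baseS n T -> commute w u) -> w = 1.
Proof.
have [_ sT abT cXT] := sXT; move=> /wreathP wX cw.
have [t tT t1] : exists2 t, t \in T & t != 1.
  by have [/trivgPn] := simpleP _ sT.
have wJ i s : s \in T -> embed i s = embed (i + w.2)%R (s ^ w.1 i).
  by move=> sT'; rewrite -embedJ; apply/esym/conjg_fixP/commgP/commute_sym/cw/embed_in_baseS.
have w0 : w.2 = 0%R.
  apply/eqP/negPn/negP => w0.
  have:= congr1 (fun v : wr gT n => v.1 (0 : 'Z_n)%R) (wJ (0 : 'Z_n)%R t tT).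
  rewrite !embed1E eqxx GRing.add0r eq_sym (negPf w0) => /eqP; exact/negP.
apply: wr_eqP => // i; rewrite wr11; apply: socle_cent1 => //.
apply/centP=> s sT'; apply/commute_sym/commgP/conjg_fixP/esym.
by apply: (@embed_inj _ _ i); rewrite wJ // w0 GRing.addr0.
Qed.

Lemma baseS_normal_in (A : {group wr gT n}) :
  baseS n T \subset A -> A \subset wreath n X -> baseS n T <| A.
Proof.
have [/normal_norm nTX _ _ _] := sXT => sMA sAW.
by rewrite /normal sMA (subset_trans sAW) ?wreath_norm_baseS.
Qed.

(** The element [w] with top component 1 shifts the factors cyclically, so a single factor contained
    in N spreads to all of them. *)
Lemma baseS_sub_normal (A N : {group wr gT n}) (w : wr gT n) :
    baseS n T \subset A -> A \subset wreath n X -> w \in A -> w.2 = 1%R ->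
    N <| A -> N :!=: 1 -> baseS n T \subset N.
Proof.
move=> sMA sAW wA w2 /andP[sNA nNA] ntN.
have [nTX sT abT cXT] := sXT.
have nMA : A \subset 'N(baseS n T) by have/normal_norm := baseS_normal_in sMA sAW.
have nNM : baseS n T \subset 'N(N) := subset_trans sMA nNA.
have ntNM : N :&: baseS n T != 1.
  (* If N met the base group trivially, their commutator, which lies in both, would vanish; then N
     would centralise the base group and be trivial. *)
  apply: contra ntN => /eqP tiNM; apply/eqP/trivgP/subsetP=> v vN.
  have vW : v \in wreath n X := subsetP sAW _ (subsetP sNA _ vN).
  apply/set1P/(cent_baseS vW) => u uM; apply/commgP/eqP.
  have /subsetP cNM : [~: N, baseS n T] \subset [1].
    rewrite -tiNM; apply: (@commg_subI _ _ _ N (baseS_group n T)).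
      by rewrite subsetI subxx (subset_trans sNA).
    by rewrite subsetI subxx.
  exact/set1P/cNM/mem_commg.
have /trivgPn[v /setIP[vN /baseSP[v0 vT]] v1] := ntNM.
have [i vi1] : exists i, v.1 i != 1.
  apply/existsP; rewrite -negb_forall; apply: contra v1 => /forallP v1.
  by apply/eqP/wr_eqP => // i; rewrite wr11; apply/eqP.
have [t tT vt1] : exists2 t, t \in T & [~ v.1 i, t] != 1.
  apply/exists_inP; rewrite -negb_forall_in; apply: contra vi1 => /forall_inP ct.
  apply/eqP/socle_cent1; first by rewrite (subsetP (normal_sub nTX)) ?vT.
  by apply/centP=> t /ct ct1; apply/commgP.
have embT j : (exists2 s, s \in T & (s != 1) && (embed j s \in N)) ->
    forall s, s \in T -> embed j s \in N.
  case=> s sT' /andP[s1 sN].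
  have /simpleP[_ simT] := sT.
  (* The elements of T whose copy in coordinate j lies in N form a normal subgroup of T; [s] shows
     that it is nontrivial, so it is all of T. *)
  case: (simT [group of T :&: @embed_morphism _ _ j @*^-1 N]) => [||/= defT u].
  - rewrite /normal subsetIl /=; apply/subsetP=> u uT; rewrite inE.
    apply/subsetP=> _ /imsetP[x xP ->]; move: xP; rewrite !inE /= => /andP[xT xN].
    rewrite groupJ //= (morphJ (@embed_morphism _ _ j)) ?inE //=.
    by rewrite memJ_norm // (subsetP nNM) ?embed_in_baseS.
  - by move/trivgP/subsetP/(_ s); rewrite !inE sT' sN (negPf s1) => /(_ isT).
  - by rewrite -[in u \in _]defT !inE => /andP[].
have embN k s : s \in T -> embed (i + k%:R)%R s \in N.
  elim: k s => [|k IH] s sT'.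
    rewrite GRing.addr0; apply: embT sT'; exists [~ v.1 i, t].
      by rewrite groupR ?vT.
    by rewrite vt1 -comm_embed // commgEl groupM ?groupV ?memJ_norm ?(subsetP nNM) ?embed_in_baseS.
  have wiX : w.1 (i + k%:R)%R \in 'N(T).
    by rewrite (subsetP (normal_norm nTX)) //; apply/wreathP/(subsetP sAW).
  (* Conjugation by [w] carries coordinate i + k to the next one with a twist by an entry of [w];
     undoing the twist beforehand stays in T because X normalises T. *)
  have -> : embed (i + k.+1%:R)%R s =
      embed (i + k%:R)%R (s ^ (w.1 (i + k%:R)%R)^-1) ^ w.
    by rewrite embedJ conjgKV w2 -GRing.addrA GRing.mulrSr.
  by rewrite memJ_norm ?(subsetP nNA) // IH // memJ_norm ?groupV.
rewrite -(bigdprodWY (bigdprod_coord_copy n T)) gen_subG.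
apply/bigcupsP=> j _; rewrite coord_copy_embed; apply/subsetP=> _ /imsetP[s sT' ->].
have -> : j = (i + (j - i : 'Z_n)%R%:R)%R by rewrite natr_Zp GRing.addrC GRing.subrK.
exact: embN.
Qed.

(** Every nontrivial normal subgroup contains the base group, which therefore is both minimal and
    the only minimal one. *)
Lemma min_normal_baseS (A N : {group wr gT n}) (w : wr gT n) :
    baseS n T \subset A -> A \subset wreath n X -> w \in A -> w.2 = 1%R ->
  min_normal_sub N A <-> N = baseS n T :> {set _}.
Proof.
move=> sMA sAW wA w2; have nMA := baseS_normal_in sMA sAW.
have ntM : baseS n T != 1.
  have [_ /simpleP[/trivgPn[t tT t1] _] _ _] := sXT.
  apply/trivgPn; exists (embed (0 : 'Z_n)%R t); first exact: embed_in_baseS.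
  apply: contra t1 => /eqP/(congr1 (fun v : wr gT n => v.1 (0 : 'Z_n)%R)).
  by rewrite embed1E eqxx wr11 => ->.
split=> [[/mingroupP[/andP[ntN nNA] minN] sNA] | defN].
  rewrite -(minN (baseS_group n T)) //; first by rewrite ntM normal_norm.
  by apply: (@baseS_sub_normal A N w) => //; rewrite /normal sNA.
split; last by rewrite defN.
apply/mingroupP; rewrite defN ntM normal_norm //; split=> // B /andP[ntB nBA] sBM.
apply/eqP; rewrite eqEsubset sBM.
by apply: (@baseS_sub_normal A B w) => //; rewrite /normal nBA (subset_trans sBM).
Qed.

End MinimalNormal.

(** * The n-th power of theta *)

Section ThetaPower.

Variables (gT : finGroupType) (b c : gT).
Hypothesis cbc : commute b c.

Lemma theta1E n (i : 'Z_n) : (theta n b c).1 i = if i == 1%R then b else b * c.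
Proof. by rewrite wrM1 !ffunE mulg1. Qed.

Lemma theta2E n : (theta n b c).2 = 1%R.
Proof. by rewrite wrM2 GRing.add0r. Qed.

(** In n steps from i the index runs through every coordinate once, and only coordinate 1 omits the
    factor c, whence the exponent n - 1. The assumption 1 < n ensures that ['Z_n] really has n
    elements. *)
Lemma theta_expn n (i : 'Z_n) : 1 < n ->
  (theta n b c ^+ n).1 i = b ^+ n * c ^+ n.-1.
Proof.
case: n i => [|[|m]] // i _.
have prodE k : \prod_(j < k) (theta m.+2 b c).1 (i + 1 *+ j)%R =
    b ^+ k * c ^+ (\sum_(j < k) (i + 1 *+ j != 1)%R)%N.
  elim: k => [|k IH]; first by rewrite !big_ord0 mulg1.
  rewrite !big_ord_recr /= IH theta1E; set e := (\sum_(_ < _) _)%N.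
  have cbe : commute (c ^+ e) b by apply/commute_sym/commuteX.
  case: eqP => _ /=; first by rewrite addn0 -mulgA cbe mulgA -expgSr.
  by rewrite addn1 -mulgA [c ^+ e * _]mulgA cbe -mulgA -expgSr mulgA -expgSr.
rewrite wrX1 theta2E prodE; congr (_ * _ ^+ _).
(* Translation by i permutes the indices, so the count of indices other than 1 does not depend on
   the starting point. *)
transitivity (\sum_(j : 'Z_m.+2) (j != 1%R))%N.
  rewrite [RHS](reindex_inj (GRing.addrI i)) /=.
  by apply: eq_bigr => j _; rewrite -[in RHS](natr_Zp j).
rewrite (bigD1 (1%R : 'Z_m.+2)) //= add0n.
rewrite (eq_bigr (fun=> 1%N)) => [|j ->] //.
by rewrite sum1_card cardC1 card_ord.
Qed.

End ThetaPower.

(** * The derived subgroup of the affine group of the line *)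

Section AffineLine.

Variable K : finFieldType.

Lemma AGL1P (s : {perm K}) :
  reflect (exists a b : K, a != 0%R /\ forall x, s x = (a * x + b)%R) (s \in AGL1 K).
Proof.
rewrite inE; apply: (iffP existsP) => [[a /existsP[b /andP[a0 /forallP sE]]]|].
  by exists a, b; split=> // x; apply/eqP.
case=> a [b [a0 sE]]; exists a; apply/existsP; exists b; rewrite a0.
by apply/forallP=> x; apply/eqP.
Qed.

Lemma AGL1_group_set : group_set (AGL1 K).
Proof.
apply/group_setP; split=> [|s t /AGL1P[a [b [a0 sE]]] /AGL1P[d [e [d0 tE]]]].
  apply/AGL1P; exists 1%R, 0%R; split=> [|x]; first exact: GRing.oner_neq0.
  by rewrite perm1 GRing.mul1r GRing.addr0.
apply/AGL1P; exists (d * a)%R, (d * b + e)%R; split=> [|x].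
  by rewrite GRing.mulf_neq0.
by rewrite permM sE tE GRing.mulrDr GRing.mulrA GRing.addrA.
Qed.

Canonical AGL1_group := Group AGL1_group_set.

Definition translation (v : K) : {perm K} := perm (@GRing.addIr K v).

(** Every translation is a commutator of a translation with multiplication by a scalar a other than
    0 and 1, which exists as the field has more than two elements. *)
Lemma card_AGL1_der1 : 2 < #|K| -> #|K| <= #|(AGL1 K)^`(1)|.
Proof.
move=> K2; have [a a0 a1] : exists2 a : K, a != 0%R & a != 1%R.
  apply/exists_inP; apply: contraTT K2; rewrite negb_exists_in => /forall_inP K01.
  rewrite -leqNgt; apply: (@leq_trans #|[set 0%R; 1%R : K]|); last first.
    by rewrite cards2; case: eqP.
  apply/subset_leq_card/subsetP=> x _; rewrite !inE.
  by have [//|/K01/negPn] := eqVneq x 0%R.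
pose m : {perm K} := perm (GRing.mulfI a0).
have trAGL v : translation v \in AGL1 K.
  apply/AGL1P; exists 1%R, v; split=> [|x]; first exact: GRing.oner_neq0.
  by rewrite permE GRing.mul1r.
have mAGL : m \in AGL1 K.
  by apply/AGL1P; exists a, 0%R; split=> // x; rewrite permE GRing.addr0.
(* The commutator with translation by d is translation by (1 - a) d, and 1 - a is invertible. *)
have tr_comm v : translation v = [~ m, translation (v / (1 - a))%R].
  set d := (v / _)%R.
  have defv : (v = d - a * d)%R.
    by rewrite -{1}[d]GRing.mul1r -GRing.mulrBl GRing.mulrC GRing.divfK // GRing.subr_eq0 eq_sym.
  apply: (mulgI (translation d * m)); rewrite -commgC.
  apply/permP=> x; rewrite !permM !permE defv.
  by rewrite GRing.mulrDr -GRing.addrA [(a * d + _)%R]GRing.addrC GRing.subrK.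
rewrite -[#|K|](card_imset _ (_ : injective translation)); last first.
  by move=> u v /permP/(_ 0%R); rewrite !permE !GRing.add0r.
apply: subset_leq_card; apply/subsetP=> _ /imsetP[v _ ->].
by rewrite tr_comm mem_commg.
Qed.

(** The quotient by F is abelian, so R' lies in F; the translations make R' at least as large as
    F. *)
Lemma der1_kernel_AGL1 (gT : finGroupType) (R F C : {group gT}) :
    2 < #|K| -> R \isog AGL1 K -> F ><| C = R -> abelian C -> #|F| = #|K| ->
  R^`(1) = F.
Proof.
move=> K2 isoR /sdprod_context[nFR _ defR _ _] abC cF.
have sRF : R^`(1) \subset F.
  by rewrite der1_min ?normal_norm // -defR quotientMidl quotient_abelian.
apply/eqP; rewrite eqEcard sRF cF (leq_trans (card_AGL1_der1 K2)) //.
case/(isogP (H := AGL1_group)): isoR => g injg <-.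
by rewrite -morphim_der // card_injm ?der_sub.
Qed.

End AffineLine.

(** * Normal subgroups of index at most two *)

Section SmallIndex.

Variables (gT : finGroupType) (X T : {group gT}).
Hypotheses (nTX : T <| X) (indT : #|X : T| <= 2).

Lemma quotient_small_index_abelian : abelian (X / T).
Proof.
have := card_quotient (normal_norm nTX) => cXT; move: indT; rewrite -cXT.
rewrite leq_eqVlt ltnS => /orP[/eqP c2|]; first by rewrite cyclic_abelian ?prime_cyclic ?c2.
by move=> c1; rewrite (card_le1_trivg c1) abelian1.
Qed.

Lemma der1_small_index : X^`(1) \subset T.
Proof. by rewrite der1_min ?normal_norm // quotient_small_index_abelian. Qed.

End SmallIndex.

(** * Arithmetic of q + 1, and generators of the complement *)

Lemma odd_div_gcd2 (q n s m : nat) : n = (q + 1)%N -> n = (2 ^ s * m)%N ->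
  3 < n -> 2 <= s \/ ~~ odd q -> odd ((q - 1) %/ gcdn 2 (q - 1)).
Proof.
move=> nq ns n3 sq; have [oddq|evenq] := boolP (odd q); last first.
  have -> : gcdn 2 (q - 1) = 1%N by apply/eqP; rewrite -/(coprime _ _) coprime2n; lia.
  by rewrite divn1; lia.
(* For odd q, 4 divides q + 1, so q = 4k + 3 and (q - 1) / 2 = 2k + 1 is odd. *)
have s2 : 2 <= s by case: sq => //; rewrite oddq.
have [k qk] : exists k, q = (4 * k + 3)%N.
  have : 4 %| q + 1 by rewrite -nq ns dvdn_mulr // (@dvdn_exp2l 2 2 s).
  by case/dvdnP=> k kE; exists k.-1; lia.
have -> : (q - 1 = (2 * k).+1 * 2)%N by lia.
by rewrite (gcdn_idPl _) ?dvdn_mull // mulnK // oddS oddM.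
Qed.

(** Applied with n = 2 + (q - 1), it makes n coprime to the odd order of b. *)
Lemma coprime_addl2 d m : odd d -> d %| m -> coprime d (2 + m).
Proof.
by move=> oddd /dvdnP[k ->]; rewrite addnC /coprime gcdnMDl -/(coprime _ _) coprimen2.
Qed.

Lemma generator_pair (gT : finGroupType) (b c : gT) k l : commute b c ->
    coprime #[b] #[c] -> coprime #[b] k -> coprime #[c] l ->
  <[b ^+ k * c ^+ l]> = <[b]> * <[c]>.
Proof.
move=> cbc bc bk cl; rewrite cycleM.
- have /eqP <- : generator <[b]> (b ^+ k) by rewrite generator_coprime.
  by have /eqP <- : generator <[c]> (c ^+ l) by rewrite generator_coprime.
- exact: commuteX2.
exact/(coprime_dvdl (orderXdvd b k))/(coprime_dvdr (orderXdvd c l)).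
Qed.

Lemma base_expg (gT : finGroupType) n (w : wr gT n) k i :
  w.2 = 0%R -> (w ^+ k).1 i = w.1 i ^+ k.
Proof.
move=> w0; elim: k => [|k IH]; first by rewrite wr11.
by rewrite !expgS wrM1 w0 GRing.addr0 IH.
Qed.

(** * The coset action of G on the cosets of H *)

Theorem theorem6p3
  (* (C1) *)
  (p f q n s r t : nat)
  (hp : prime p) (hf : 0 < f) (hq : q = (p ^ f)%N) (hn : n = (q + 1)%N)
  (hns : n = (2 ^ s * r ^ t)%N) (hn3 : 3 < n) (hr : prime r) (hrodd : odd r)
  (hsq : (2 <= s) \/ ~~ odd q)
  (* (C2) *)
  (gT : finGroupType) (X T R F : {group gT}) (b c : gT)
  (hXT : almost_simple_socle X T) (hidx : #|X : T| <= 2)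
  (hRX : R \subset X)
  (K : finFieldType) (hK : #|K| = q) (hRagl : R \isog AGL1 K)
  (hRdec : F ><| (<[b]> \x <[c]>) = R)
  (hF : elem_ab_rank p f F)
  (hb : #[b] = (q - 1) %/ gcdn 2 (q - 1)) (hc : #[c] = gcdn 2 (q - 1))
  (* E *)
  (E : {group wr gT n})
  (hEmin : min_normal_sub E (baseS n F <*> <[theta n b c]>))
  (hEbase : E \subset baseS n X)
  (hE1 : elem_ab_rank p (2 * f)%N E)
  (hE2 : [transitive <[theta n b c]>, on E^# | 'J])
  (hE3a : forall i : 'Z_n, proj i @: E = F)
  (hE3b : forall i j : 'Z_n, i != j ->
            [set e in E | proj i e == 1] != [set e in E | proj j e == 1]) :
  let G := baseS n T <*> <[theta n b c]> in
  let H := E <*> <[theta n b c]> in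
  let M := baseS n T in
  [/\ (* [G:H] makes sense and G acts faithfully and transitively on it *)
      [/\ H \subset G,
          [faithful G, on rcosets H G | 'Rs] &
          [transitive G, on rcosets H G | 'Rs]],
      (* quasiprimitive: every minimal normal subgroup is transitive *)
      (forall N : {group wr gT n}, min_normal_sub N G ->
         [transitive N, on rcosets H G | 'Rs]),
      (* T^n is the unique minimal normal subgroup, = T_1 x ... x T_n *)
      (forall N : {group wr gT n}, min_normal_sub N G <-> N = M :> {set _}),
      (\big[dprod/1]_(i : 'Z_n) coord_copy T i = M /\
        (forall i : 'Z_n, coord_copy T i \isog T)) &
      (* PA type: M_H = T^n :&: H is a subdirect product of (R :&: T)^n,
         with 1 < R :&: T < T, and it is non-diagonal *)
      [/\ R :&: T != 1, R :&: T \proper T,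
          M :&: H \subset baseS n (R :&: T),
          (forall i : 'Z_n, proj i @: (M :&: H) = R :&: T) &
          exists i : 'Z_n, ~ {in M :&: H &, injective (@proj gT n i)}]].
Proof.
move=> G H M.
have q2 : 2 < q by lia.
have n1 : 1 < n by lia.
have n2 : n = (2 + (q - 1))%N by lia.
have nq1 : n.-1 = (q - 1).+1 by lia.
have [nTX sT abT cXT] := hXT.
have [pF cF] := hF.
have [[_ C _ defC] defR nFC tiFC] := sdprodP hRdec.
rewrite defC in hRdec defR nFC tiFC.
have [_ defbc cbc _] := dprodP defC.
have {}cbc : commute b c.
  by apply/commute_sym/(centsP cbc); rewrite cycle_id.
have oddb : odd #[b] by rewrite hb; apply: odd_div_gcd2 hn hns hn3 hsq.
have c2 : #[c] %| 2 by rewrite hc dvdn_gcdl.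
have cq : #[c] %| q - 1 by rewrite hc dvdn_gcdr.
have bq : #[b] %| q - 1 by rewrite hb dvdn_div ?dvdn_gcdr.
(* This is the common value of all coordinates of theta^n. It generates C because n is coprime to
   the order of b, and n - 1 = q to that of c. *)
pose u := b ^+ n * c ^+ n.-1.
have defu : <[u]> = C.
  rewrite generator_pair //.
  - by rewrite (coprime_dvdr c2) // coprimen2.
  - by rewrite n2 coprime_addl2.
  - by rewrite (coprime_dvdl cq) // nq1 coprimenS.
have thW : theta n b c \in wreath n X.
  have sCX : C \subset X.
    by rewrite (subset_trans _ hRX) // -defR mulG_subr.
  have bX : b \in X by rewrite (subsetP sCX) // -defbc (subsetP (mulG_subl _ _)) ?cycle_id.
  have cX : c \in X by rewrite (subsetP sCX) // -defbc (subsetP (mulG_subr _ _)) ?cycle_id.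
  by apply/wreathP=> i; rewrite theta1E; case: ifP => _ //; rewrite groupM.
have sFR : F \subset R by rewrite -defR mulG_subl.
have sFT : F \subset T.
  rewrite -(der1_kernel_AGL1 (K := K) _ hRagl hRdec) ?hK ?cF //; last first.
    by rewrite -defu cycle_abelian.
  exact: subset_trans (dergS 1 hRX) (der1_small_index nTX hidx).
have ntF : F :!=: 1.
  by rewrite trivg_card_le1 cF -hq -ltnNge ltnW.
(* If T were contained in R, then F would be a nontrivial normal subgroup of the simple group T,
   making T = F abelian. *)
have pRT : R :&: T \proper T.
  rewrite properE subsetIr; apply: contra abT => /subsetIP[sTR _].
  have nFT : F <| T.
    rewrite /normal sFT (subset_trans sTR) //.
    by case/sdprod_context: hRdec => /andP[].
  have [_ /(_ _ nFT)[F1|<-]] := simpleP _ sT; last exact: abelem_abelian pF.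
  by rewrite F1 eqxx in ntF.
have ntRT : R :&: T != 1.
  apply: contra ntF => /eqP RT1; apply/eqP/trivgP; rewrite -RT1.
  by rewrite subsetI sFR.
have EF (e : wr gT n) : e \in E -> e.2 = 0%R /\ forall i, e.1 i \in F.
  move=> eE; have /baseSP[e0 _] := subsetP hEbase e eE.
  by split=> // i; rewrite -(hE3a i); apply: imset_f.
have sEM : E \subset M.
  apply/subsetP=> e /EF[e0 eF]; apply/baseSP; split=> // i.
  exact: (subsetP sFT).
have thG : theta n b c \in G by rewrite (subsetP (joing_subr _ _)) ?cycle_id.
have sMG : M \subset G := joing_subl _ _.
have sGW : G \subset wreath n X.
  by rewrite join_subG cycle_subG thW baseS_sub_wreath // normal_sub.
have sHG : H \subset G by rewrite join_subG (subset_trans sEM) // joing_subr.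
have nEth : <[theta n b c]> \subset 'N(E).
  have [/mingroupP[/andP[_ nE] _] _] := hEmin.
  exact: subset_trans (joing_subr _ _) nE.
have nMth : <[theta n b c]> \subset 'N(M).
  by rewrite cycle_subG (subsetP (wreath_norm_baseS _ (normal_norm nTX))).
have defG : G = M * <[theta n b c]> by rewrite -norm_joinEr.
have defH : H = E * <[theta n b c]> by rewrite -norm_joinEr.
have minM := @min_normal_baseS _ n X T hXT [group of G] _ _ sMG sGW thG (theta2E _ _ _).
have thn k : (theta n b c ^+ (n * k)).2 = 0%R /\
    forall i, (theta n b c ^+ (n * k)).1 i = u ^+ k.
  have thn0 : (theta n b c ^+ n).2 = 0%R by rewrite wrX2 theta2E pchar_Zp.
  split=> [|i]; first by rewrite expgM wrX2 thn0 GRing.mul0rn.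
  by rewrite expgM base_expg // theta_expn.
have sMHR : M :&: H \subset baseS n (R :&: T).
  apply/subsetP=> w /setIP[/baseSP[w0 wT]]; rewrite defH.
  case/mulsgP=> e _ eE /cycleP[k ->] defw; have [e0 eF] := EF e eE.
  (* Elements of E have top component 0, so that of e theta^k is k modulo n; it vanishes only if
     theta^k is a power of theta^n, with all entries in C. *)
  have /dvdnP[m defk] : n %| k.
    move: w0; rewrite defw wrM2 e0 GRing.add0r wrX2 theta2E => /(congr1 val).
    by rewrite /= val_Zp_nat // => /eqP.
  apply/baseSP; split=> // i; rewrite inE wT andbT defw wrM1 e0 GRing.addr0.
  rewrite defk mulnC (thn m).2 -defR mem_mulg //.
  by rewrite -defu mem_cycle.
have projMH i : proj i @: (M :&: H) = R :&: T.
  apply/eqP; rewrite eqEsubset; apply/andP; split; apply/subsetP=> x.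
    by case/imsetP=> w /(subsetP sMHR)/baseSP[_ wRT] ->; apply: wRT.
  (* Write x = y u^k with y in F, and lift y to e in E: then e theta^(nk) has i-th entry x. As x and
     y lie in T, so does u^k, which puts all the other entries in T too. *)
  case/setIP; rewrite -{1}defR => /mulsgP[y z]; rewrite -{1}(hE3a i).
  case/imsetP=> e eE -> ; rewrite -defu => /cycleP[k ->] -> xT.
  have [e0 eF] := EF e eE.
  have [th0 thu] := thn k.
  apply/imsetP; exists (e * theta n b c ^+ (n * k)); last first.
    by rewrite /proj wrM1 e0 GRing.addr0 thu.
  rewrite inE defH mem_mulg ?mem_cycle // andbT; apply/baseSP.
  rewrite wrM2 e0 th0 GRing.addr0; split=> // j.
  rewrite wrM1 e0 thu groupM ?(subsetP sFT _ (eF j)) //.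
  by rewrite -(groupMl _ (subsetP sFT _ (eF i))).
have trM : [transitive M, on rcosets H G | 'Rs].
  apply/(subgroup_transitiveP (G := [group of G]) (H := baseS_group n T) (x := H)).
  - by apply/rcosetsP; exists 1; rewrite ?group1 ?rcoset1.
  - exact: sMG.
  - exact: transRs_rcosets.
  (* The stabiliser in G of the coset H is H itself, so transitivity of M amounts to G = H M. *)
  rewrite astab1Rs (setIidPr sHG) /=; apply/eqP; rewrite eqEsubset mul_subG //=.
  by rewrite defG -(normC nMth) mulSg // joing_subr.
(* An element of T outside R, placed in coordinate 0, lies in M but not in H. *)
have nthMH : ~ M \subset H.
  move=> sMH; have /properP[_ [y yT /negP]] := pRT; case.
  have yM := embed_in_baseS (0%R : 'Z_n) yT.
  have yMH : embed (0%R : 'Z_n) y \in M :&: H by rewrite inE yM (subsetP sMH).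
  have /baseSP[_ yRT] := subsetP sMHR _ yMH.
  by have := yRT 0%R; rewrite embed1E eqxx.
split.
- split=> //; last exact: transRs_rcosets.
  rewrite /faithful astabRs_rcosets.
  (* The kernel of the action is the core of H; were it nontrivial, it would contain M, and so would
     H. *)
  have [->|ntcore] := eqVneq (gcore H G) 1; first exact: subsetIr.
  case: nthMH; apply: subset_trans (gcore_sub H [group of G]).
  apply: (@baseS_sub_normal _ n X T hXT [group of G] _ _ sMG sGW thG (theta2E _ _ _)) => //.
  exact: gcore_normal.
- by move=> N /minM ->.
- exact: minM.
- split; [exact: bigdprod_coord_copy | exact: coord_copy_isog].
split=> //; exists 0%R => injMH.
(* Injectivity on M :&: H would restrict to E and force p^f = p^(2f), impossible for positive f. *)
have : #|proj (0%R : 'Z_n) @: E| = #|E|.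
  apply: card_in_imset => v w vE wE; apply: injMH; rewrite inE.
    by rewrite (subsetP sEM) // (subsetP (joing_subl _ _)).
  by rewrite (subsetP sEM) // (subsetP (joing_subl _ _)).
rewrite hE3a cF hE1.2 => /eqP; rewrite eqn_exp2l ?prime_gt1 //.
by rewrite mul2n -addnn -{1}[f]addn0 eqn_add2l eq_sym -leqn0 leqNgt hf.
Qed.
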